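(* Let $n\ge2$ and for $1\le i,j\le n$ let $E_{ij}=e_ie_j^\top+e_je_i^\top\in\mathcal{S}^n$. Then $$\mathcal{R}_{\mathcal{COP}}=\operatorname{conv}\{P\in\mathcal{S}^n: P \text{ perfect copositive},\ \min_{\mathcal{COP}}P=1\}+\operatorname{cone}\{E_{ij}: i\ne j\}.$$
   Context: $\mathcal{S}^n$: real symmetric $n\times n$ matrices; $e_i$: standard unit vectors; $B[v]=v^\top Bv$. $\mathcal{R}_{\mathcal{COP}}=\{B\in\mathcal{S}^n: B[v]\ge1 \text{ for all } v\in\mathbb{Z}^n_{\ge0}\setminus\{0\}\}$ is the copositive Ryshkov polyhedron. $\mathcal{COP}^n=\{B\in\mathcal{S}^n: B[x]\ge0\ \forall x\in\mathbb{R}^n_{\ge0}\}$; strictly copositive means lying in its interior; $\min_{\mathcal{COP}}B=\inf\{B[v]: v\in\mathbb{Z}^n_{\ge0}\setminus\{0\}\}$, $\operatorname{Min}_{\mathcal{COP}}B=\{v\in\mathbb{Z}^n_{\ge0}: B[v]=\min_{\mathcal{COP}}B\}$; a strictly copositive $P$ is perfect copositive if it is the unique $Q\in\mathcal{S}^n$ with $Q[v]=\min_{\mathcal{COP}}P$ for all $v\in\operatorname{Min}_{\mathcal{COP}}P$. $\operatorname{conv}$ and $\operatorname{cone}$ denote convex hull and convex conic hull (finite nonnegative combinations). *)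

(* Defs.v *)
From HB Require Import structures.
From mathcomp Require Import all_boot all_order all_algebra.
From mathcomp Require Import boolp classical_sets reals.
Set Implicit Arguments. Unset Strict Implicit. Unset Printing Implicit Defensive.
Import Order.TTheory GRing.Theory Num.Theory.
Local Open Scope ring_scope.
Local Open Scope classical_set_scope.

Section CopDefs.
Variables (R : realType) (n : nat).

Definition symmetric (B : 'M[R]_n) : Prop := B^T = B.

Definition qf (B : 'M[R]_n) (x : 'cV[R]_n) : R := (x^T *m B *m x) 0 0.

Definition natcv (v : 'I_n -> nat) : 'cV[R]_n := \col_i (v i)%:R.

Definition nonzero_nat (v : 'I_n -> nat) : Prop := exists i, v i <> 0%N.

Definition RCOP (B : 'M[R]_n) : Prop :=
  symmetric B /\ forall v, nonzero_nat v -> 1 <= qf B (natcv v).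

Definition copositive (B : 'M[R]_n) : Prop :=
  symmetric B /\ forall x : 'cV[R]_n, (forall i, 0 <= x i 0) -> 0 <= qf B x.

(* interior of COP^n inside S^n (max-entry norm topology on S^n) *)
Definition strictly_copositive (B : 'M[R]_n) : Prop :=
  symmetric B /\ exists eps : R, 0 < eps /\
    forall C : 'M[R]_n, symmetric C -> (forall i j, `|C i j - B i j| < eps) ->
      copositive C.

Definition minCOP (B : 'M[R]_n) : R :=
  inf [set qf B (natcv v) | v in [set v | nonzero_nat v]].

Definition MinCOP (B : 'M[R]_n) (v : 'I_n -> nat) : Prop :=
  qf B (natcv v) = minCOP B.

Definition perfect_copositive (P : 'M[R]_n) : Prop :=
  strictly_copositive P /\
  forall Q : 'M[R]_n, symmetric Q ->
    (forall v, MinCOP P v -> qf Q (natcv v) = minCOP P) -> Q = P.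

Definition conv (S : 'M[R]_n -> Prop) (X : 'M[R]_n) : Prop :=
  exists (k : nat) (A : 'I_k -> 'M[R]_n) (c : 'I_k -> R),
    (forall l, S (A l)) /\ (forall l, 0 <= c l) /\ \sum_l c l = 1 /\
    X = \sum_l c l *: A l.

Definition cone (S : 'M[R]_n -> Prop) (X : 'M[R]_n) : Prop :=
  exists (k : nat) (A : 'I_k -> 'M[R]_n) (c : 'I_k -> R),
    (forall l, S (A l)) /\ (forall l, 0 <= c l) /\
    X = \sum_l c l *: A l.

Definition Emx (i j : 'I_n) : 'M[R]_n := delta_mx i j + delta_mx j i.

Definition perfect_min1 (P : 'M[R]_n) : Prop :=
  perfect_copositive P /\ minCOP P = 1.

Definition E_offdiag (X : 'M[R]_n) : Prop :=
  exists i j : 'I_n, i <> j /\ X = Emx i j.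

End CopDefs.

(* Main.v *)
From mathcomp Require Import all_boot all_order all_algebra.
From mathcomp Require Import boolp classical_sets reals.
From mathcomp Require Import topology normedtype derive ring lra.
Require Import Defs.
Set Implicit Arguments. Unset Strict Implicit. Unset Printing Implicit Defensive.
Import Order.TTheory GRing.Theory Num.Theory.
Import numFieldNormedType.Exports.
Local Open Scope ring_scope.

(** For B in the Ryshkov polyhedron let M(B) be the set of v with B[v] = 1 and W(B) the space of
    symmetric Y vanishing on M(B).  A matrix B of the polyhedron is strictly copositive: a zero x
    of B in the orthant can be approximated, inside its support and after scaling, by integer
    vectors v = q x + d, and then B[v] = B[d] < 1.  By compactness B[x] >= c (sum x)^2 on the
    orthant, so the polyhedron is locally finite, and B is a vertex, hence perfect, when
    W(B) = 0.  Otherwise one moves from B along a line inside W(B) until a new integer vector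
    becomes tight, which lowers dim W.  If some Y in W(B) takes both signs on integer vectors of
    the orthant, B lies between the two ends of the line.  If not, take X <> 0 in W(B) copositive
    (up to sign): since v_i (X v)_i = 0 for all v in M(B), the symmetrised i-th rows of X also
    lie in W(B), and this forces some E_ij with i <> j into W(B); then B = B' + t E_ij with B'
    the end of the ray in direction - E_ij. *)

(** * Quadratic forms *)

(** An explicit double sum, so that bilinearity and entrywise bounds are checked term by term. *)
Definition bf (R : realType) (n : nat) (B : 'M[R]_n) (x y : 'cV[R]_n) : R :=
  \sum_i \sum_j x i 0 * B i j * y j 0.

Lemma qfE (R : realType) (n : nat) (B : 'M[R]_n) (x : 'cV[R]_n) :
  qf B x = bf B x x.
Proof.
rewrite /qf /bf mxE exchange_big /=; apply: eq_bigr => j _.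
rewrite mxE mulr_suml; apply: eq_bigr => i _.
by rewrite mxE.
Qed.

Lemma bf_comb (R : realType) (n : nat) (A B : 'M[R]_n) (a b : R) (x y : 'cV[R]_n) :
  bf (a *: A + b *: B) x y = a * bf A x y + b * bf B x y.
Proof.
rewrite /bf !mulr_sumr -big_split; apply: eq_bigr => i _ /=.
rewrite !mulr_sumr -big_split; apply: eq_bigr => j _ /=.
by rewrite !mxE; ring.
Qed.

Lemma bf_combl (R : realType) (n : nat) (B : 'M[R]_n) (a b : R) (x y z : 'cV[R]_n) :
  bf B (a *: x + b *: y) z = a * bf B x z + b * bf B y z.
Proof.
rewrite /bf !mulr_sumr -big_split; apply: eq_bigr => i _ /=.
rewrite !mulr_sumr -big_split; apply: eq_bigr => j _ /=.
by rewrite !mxE; ring.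
Qed.

Lemma bf_trmx (R : realType) (n : nat) (B : 'M[R]_n) (x y : 'cV[R]_n) :
  bf B^T x y = bf B y x.
Proof.
rewrite /bf exchange_big; apply: eq_bigr => i _; apply: eq_bigr => j _ /=.
by rewrite mxE; ring.
Qed.

Lemma qf_comb (R : realType) (n : nat) (A B : 'M[R]_n) (a b : R) (x : 'cV[R]_n) :
  qf (a *: A + b *: B) x = a * qf A x + b * qf B x.
Proof. by rewrite !qfE bf_comb. Qed.

Lemma qfD (R : realType) (n : nat) (A B : 'M[R]_n) (x : 'cV[R]_n) :
  qf (A + B) x = qf A x + qf B x.
Proof. by rewrite -[A]scale1r -[B]scale1r qf_comb !scale1r !mul1r. Qed.

Lemma qfZ (R : realType) (n : nat) (A : 'M[R]_n) (a : R) (x : 'cV[R]_n) :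
  qf (a *: A) x = a * qf A x.
Proof. by rewrite -[a *: A]addr0 -(scale0r A) qf_comb mul0r addr0. Qed.

Lemma qf0mx (R : realType) (n : nat) (x : 'cV[R]_n) : qf 0 x = 0.
Proof. by rewrite -[0 in LHS](scale0r (0 : 'M[R]_n)) qfZ mul0r. Qed.

Lemma qf_sum (R : realType) (n k : nat) (A : 'I_k -> 'M[R]_n) (x : 'cV[R]_n) :
  qf (\sum_l A l) x = \sum_l qf (A l) x.
Proof.
apply: (big_morph (fun A : 'M[R]_n => qf A x)) => [C D|]; first exact: qfD.
exact: qf0mx.
Qed.

Lemma qf_expand (R : realType) (n : nat) (B : 'M[R]_n) (a b : R) (x y : 'cV[R]_n) :
  symmetric B ->
  qf B (a *: x + b *: y) = a ^+ 2 * qf B x + 2 * a * b * bf B y x + b ^+ 2 * qf B y.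
Proof.
move=> sB; rewrite !qfE bf_combl.
have sw u v : bf B u v = bf B v u by rewrite -bf_trmx sB.
by rewrite ![bf B _ (_ + _)]sw !bf_combl (sw x y); ring.
Qed.

Lemma qf_scalev (R : realType) (n : nat) (B : 'M[R]_n) (a : R) (x : 'cV[R]_n) :
  qf B (a *: x) = a ^+ 2 * qf B x.
Proof.
rewrite !qfE /bf mulr_sumr; apply: eq_bigr => i _; rewrite mulr_sumr.
by apply: eq_bigr => j _; rewrite !mxE; ring.
Qed.

Lemma qf0 (R : realType) (n : nat) (B : 'M[R]_n) : qf B 0 = 0.
Proof. by rewrite -[0 in LHS](scale0r (0 : 'cV[R]_n)) qf_scalev expr0n mul0r. Qed.

Lemma qf_trmx (R : realType) (n : nat) (A : 'M[R]_n) (x : 'cV[R]_n) :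
  qf A^T x = qf A x.
Proof. by rewrite !qfE bf_trmx. Qed.

Lemma bf_delta (R : realType) (n : nat) (B : 'M[R]_n) (i : 'I_n) (x : 'cV[R]_n) :
  bf B (delta_mx i 0) x = \sum_j B i j * x j 0.
Proof.
rewrite /bf (bigD1 i) //= [X in _ + X]big1 ?addr0 => [|k ki].
  by apply: eq_bigr => j _; rewrite mxE !eqxx mul1r.
by apply: big1 => j _; rewrite mxE (negbTE ki) !mul0r.
Qed.

Lemma qf_delta (R : realType) (n : nat) (B : 'M[R]_n) (i : 'I_n) :
  qf B (delta_mx i 0) = B i i.
Proof.
rewrite qfE bf_delta (bigD1 i) //= big1 => [|k ki]; first by rewrite mxE !eqxx mulr1 addr0.
by rewrite mxE (negbTE ki) mulr0.
Qed.

Lemma bf_norm_le (R : realType) (n : nat) (B : 'M[R]_n) (D : R) (x y : 'cV[R]_n) :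
  (forall i j, `|B i j| <= D) ->
  `|bf B x y| <= D * ((\sum_i `|x i 0|) * (\sum_i `|y i 0|)).
Proof.
move=> hB; apply: le_trans (ler_norm_sum _ _ _) _.
rewrite mulr_suml mulr_sumr; apply: ler_sum => i _.
apply: le_trans (ler_norm_sum _ _ _) _.
rewrite !mulr_sumr; apply: ler_sum => j _.
rewrite !normrM mulrAC mulrC ler_wpM2r ?mulr_ge0 //.
Qed.

Lemma mx_entries_bounded (R : realType) (n : nat) (B : 'M[R]_n) :
  exists2 D : R, 0 < D & forall i j, `|B i j| <= D.
Proof.
exists (1 + \sum_i \sum_j `|B i j|) => [|i j].
  by rewrite ltr_wpDr // sumr_ge0 // => i _; rewrite sumr_ge0.
rewrite (bigD1 i) //= (bigD1 j) //= addrCA -!addrA lerDl !addr_ge0 // ?sumr_ge0 //.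
by move=> k _; rewrite sumr_ge0.
Qed.

Lemma qf_Emx (R : realType) (n : nat) (i j : 'I_n) (x : 'cV[R]_n) :
  qf (Emx R i j) x = 2 * (x i 0 * x j 0).
Proof.
have -> : Emx R i j = delta_mx i j + (delta_mx i j)^T by rewrite trmx_delta.
rewrite qfD qf_trmx qfE /bf (bigD1 i) //= (bigD1 j) //= !big1.
- by rewrite mxE !eqxx /=; ring.
- by move=> k ki; apply: big1 => l _; rewrite mxE (negbTE ki) mulr0 mul0r.
- by move=> l lj; rewrite mxE (negbTE lj) andbF mulr0 mul0r.
Qed.

Lemma symmetric_Emx (R : realType) (n : nat) (i j : 'I_n) : symmetric (Emx R i j).
Proof. by rewrite /symmetric /Emx linearD /= !trmx_delta [LHS]addrC. Qed.

Lemma symmetricD (R : realType) (n : nat) (A B : 'M[R]_n) :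
  symmetric A -> symmetric B -> symmetric (A + B).
Proof. by rewrite /symmetric linearD /= => -> ->. Qed.

Lemma symmetricZ (R : realType) (n : nat) (a : R) (A : 'M[R]_n) :
  symmetric A -> symmetric (a *: A).
Proof. by rewrite /symmetric linearZ /= => ->. Qed.

Lemma symmetric_sum (R : realType) (n k : nat) (A : 'I_k -> 'M[R]_n) :
  (forall l, symmetric (A l)) -> symmetric (\sum_l A l).
Proof. by move=> sA; rewrite /symmetric linear_sum; apply: eq_bigr => l _; exact: sA. Qed.

(** * Diophantine approximation *)

Lemma natr_unbounded (R : realType) (x : R) : exists2 N : nat, (0 < N)%N & x < N%:R.
Proof. by exists (Num.truncn x).+1 => //; exact: truncnS_gt. Qed.

Lemma natcv_eq0 (R : realType) (n : nat) (v : 'I_n -> nat) :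
  ~ nonzero_nat v -> natcv R v = 0.
Proof.
move=> v0; apply/colP => i; rewrite !mxE; case: (eqVneq (v i) 0%N) => [->//|vi].
by case: v0; exists i; apply/eqP.
Qed.

Lemma RCOP_natcv_ge0 (R : realType) (n : nat) (B : 'M[R]_n) (v : 'I_n -> nat) :
  RCOP B -> 0 <= qf B (natcv R v).
Proof.
move=> [_ hB]; have [/hB|/natcv_eq0 ->] := pselect (nonzero_nat v); first exact: le_trans.
by rewrite qf0.
Qed.

(** If [B[x] < 0] with [x >= 0], rounding [N x] down changes the form only by [O(N)], which [N^2
    B[x]] outweighs: an integer vector of negative value results. *)
Lemma RCOP_copositive (R : realType) (n : nat) (B : 'M[R]_n) : RCOP B -> copositive B.
Proof.
move=> RB; split=> [|x x0]; first by case: RB.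
have [D D0 hD] := mx_entries_bounded B.
rewrite leNgt; apply/negP => qx.
set s := \sum_i `|x i 0|.
have s0 : 0 <= s by rewrite sumr_ge0.
have n0 : 0 <= n%:R :> R by [].
(* The error terms add up to at most [N] times the numerator, hence stay below [N^2 |B[x]|]. *)
have [N N0 hN] := natr_unbounded ((2 * (D * (n%:R * s)) + D * (n%:R * n%:R)) / - qf B x).
have N1 : 1 <= N%:R :> R by rewrite ler1n.
rewrite ltr_pdivrMr ?oppr_gt0 // in hN.
pose v i := Num.truncn (N%:R * x i 0).
pose d := natcv R v - N%:R *: x.
have d1 i : `|d i 0| <= 1.
  have /truncn_itv : 0 <= N%:R * x i 0 by rewrite mulr_ge0.
  rewrite !mxE -/(v i) -natr1 => /andP[h1 h2]; rewrite ler_norml; lra.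
have sd : \sum_i `|d i 0| <= n%:R.
  by apply: le_trans (ler_sum _ (fun i _ => d1 i)) _; rewrite sumr_const card_ord.
have sd0 : 0 <= \sum_i `|d i 0| by rewrite sumr_ge0.
have := RCOP_natcv_ge0 v RB.
have -> : natcv R v = N%:R *: x + 1 *: d by rewrite scale1r addrC subrK.
rewrite qf_expand; last by case: RB.
have /ler_normlW h1 := bf_norm_le d x hD.
have /ler_normlW h2 := bf_norm_le d d hD; rewrite -qfE in h2.
have h3 : bf B d x <= D * (n%:R * s).
  by apply: le_trans h1 _; rewrite ler_wpM2l ?(ltW D0) // ler_wpM2r.
have h4 : qf B d <= D * (n%:R * n%:R).
  by apply: le_trans h2 _; rewrite ler_wpM2l ?(ltW D0) // ler_pM.
have p1 : 0 <= D * (n%:R * s) by rewrite !mulr_ge0 // ltW.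
have p2 : 0 <= D * (n%:R * n%:R) by rewrite !mulr_ge0 // ltW.
move: h3 h4 hN p1 p2 {h1 h2}.
set a := bf B d x; set b := qf B d; set c := qf B x; set e := D * (n%:R * s).
set f := D * (n%:R * n%:R) => h3 h4 hN p1 p2.
rewrite leNgt; apply/negP/negPn; nra.
Qed.

(** Pigeonhole on the fractional parts of [k x], [0 <= k <= Q^n], in the [Q^n] boxes of side [1/Q].
    The clause on zero coordinates keeps the approximation inside the support of [x]. *)
Lemma simultaneous_dirichlet (R : realType) (n Q : nat) (x : 'I_n -> R) :
  (0 < Q)%N -> (forall i, 0 <= x i) ->
  exists (q : nat) (v : 'I_n -> nat), (0 < q)%N /\
    forall i, `|(v i)%:R - q%:R * x i| <= Q%:R^-1 /\ (x i = 0 -> v i = 0%N).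
Proof.
case: Q => // Q _ x0.
pose fr (k : nat) i := k%:R * x i - (Num.truncn (k%:R * x i))%:R.
have frP k i : 0 <= fr k i < 1.
  have /truncn_itv : 0 <= k%:R * x i by rewrite mulr_ge0.
  by rewrite /fr -natr1 => /andP[h1 h2]; apply/andP; split; lra.
pose c (k : 'I_(Q.+1 ^ n).+1) : {ffun 'I_n -> 'I_Q.+1} :=
  [ffun i => inord (Num.truncn (Q.+1%:R * fr k i))].
have : ~~ injectiveb c.
  apply/negP => /injectiveP /leq_card; rewrite card_ffun !card_ord ltnn //.
case/injectivePn => k1 [k2 k12 ck].
wlog lt12 : k1 k2 k12 ck / (k1 < k2)%N => [hw|].
  have [l|l|/val_inj e] := ltngtP k1 k2; first exact: hw l.
    by apply: (hw k2 k1) => //; rewrite eq_sym.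
  by rewrite e eqxx in k12.
exists (k2 - k1)%N, (fun i => Num.truncn (k2%:R * x i) - Num.truncn (k1%:R * x i))%N.
split=> [|i]; first by rewrite subn_gt0.
split; last by move=> ->; rewrite !mulr0 subnn.
have le12 : k1%:R * x i <= k2%:R * x i by rewrite ler_wpM2r // ler_nat ltnW.
rewrite natrB; last exact: le_truncn.
rewrite natrB ?(ltnW lt12) //.
have -> : (Num.truncn (k2%:R * x i))%:R - (Num.truncn (k1%:R * x i))%:R
          - (k2%:R - k1%:R) * x i = fr k1 i - fr k2 i.
  by rewrite /fr; ring.
have Q0 : 0 < Q.+1%:R :> R by rewrite ltr0n.
have tP k : exists2 m : nat, Num.truncn (Q.+1%:R * fr k i) = m &
    m%:R <= Q.+1%:R * fr k i < m%:R + 1 /\ (m < Q.+1)%N.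
  have [f0 f1] := andP (frP k i).
  have Qf0 : 0 <= Q.+1%:R * fr k i by rewrite mulr_ge0.
  eexists; first reflexivity.
  have h := truncn_itv Qf0; rewrite natr1; split=> //.
  rewrite ltnS truncn_le_nat.
  by rewrite -[X in _ < X]mulr1 ltr_pM2l.
move/ffunP/(_ i): ck; rewrite !ffunE.
have [m1 -> [/andP[a1 b1] l1]] := tP k1; have [m2 -> [/andP[a2 b2] l2]] := tP k2.
move/(congr1 (@nat_of_ord _)); rewrite !inordK // => e; subst m2.
rewrite -(ler_pM2l Q0) divff ?gt_eqF // -[Q.+1%:R in X in X <= _]gtr0_norm // -normrM.
by rewrite mulrBr ler_norml; lra.
Qed.

(** [x] minimises [B] on the orthant and its [i]-th coordinate can move both ways, so the linear
    term in that direction vanishes. *)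
Lemma copositive_kernel (R : realType) (n : nat) (B : 'M[R]_n) (x : 'cV[R]_n) (i : 'I_n) :
  copositive B -> (forall i, 0 <= x i 0) -> qf B x = 0 -> x i 0 <> 0 ->
  \sum_j B i j * x j 0 = 0.
Proof.
move=> [sB cB] x0 qx /eqP xi; rewrite -bf_delta.
have xi0 : 0 < x i 0 by rewrite lt0r xi x0.
set g := bf B _ x; set h := B i i.
have key t : `|t| <= x i 0 -> 0 <= 2 * t * g + t ^+ 2 * h.
  move=> ht; have := cB (1 *: x + t *: delta_mx i 0) _.
  rewrite qf_expand // qf_delta qx mulr0 add0r mulr1; apply=> j.
  rewrite !mxE mul1r; case: eqP => [->|_]; rewrite ?mulr0 ?addr0 //=.
  by move: ht; rewrite mulr1 ler_norml => /andP[]; lra.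
apply: contrapT => /eqP g0.
(* Small enough to stay in the orthant and for the linear term [2 c |g|] to beat [c^2 h]. *)
pose c := Num.min (x i 0) (`|g| / (1 + `|h|)).
have h0 : 0 < 1 + `|h| by rewrite ltr_pwDl.
have c0 : 0 < c by rewrite lt_min xi0 divr_gt0 // normr_gt0.
have cx : c <= x i 0 by rewrite ge_min lexx.
have cg : c * (1 + `|h|) <= `|g| by rewrite -ler_pdivlMr // ge_min lexx orbT.
have hh : h <= `|h| by exact: ler_norm.
have /key : `|c| <= x i 0 by rewrite gtr0_norm.
have /key : `|- c| <= x i 0 by rewrite normrN gtr0_norm.
have e1 : c * (c * (1 + `|h|)) <= c * `|g| by rewrite ler_wpM2l // ltW.
have e2 : c * c * h <= c * c * `|h| by rewrite ler_wpM2l // mulr_ge0 // ltW.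
have e3 : 0 < c * `|g| by rewrite mulr_gt0 // normr_gt0.
have e4 : 0 < c * c by rewrite mulr_gt0.
rewrite !expr2 => k1 k2.
have [gp|gn] := ltrP 0 g; [rewrite (gtr0_norm gp) in e1 e3|rewrite (ler0_norm gn) in e1 e3]; lra.
Qed.

(* A zero of the form would, by simultaneous approximation inside its support,
   give integer vectors whose value is that of the approximation error. *)
Lemma RCOP_qf_neq0 (R : realType) (n : nat) (B : 'M[R]_n) (x : 'cV[R]_n) :
  RCOP B -> (forall i, 0 <= x i 0) -> \sum_i x i 0 = 1 -> qf B x <> 0.
Proof.
move=> RB x0 sx qx.
have cB := RCOP_copositive RB; have [sB hB] := RB.
have [D D0 hD] := mx_entries_bounded B.
(* With [e = n/Q] this gives [e (1 + D) < 1], hence [e < 1] and [D e^2 < 1]. *)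
have [Q Q0 hQ] := natr_unbounded (n%:R * (1 + D)).
have Qp : 0 < Q%:R :> R by rewrite ltr0n.
have [q [v [q0 hv]]] := simultaneous_dirichlet Q0 x0.
pose d := natcv R v - q%:R *: x.
have ev : natcv R v = q%:R *: x + 1 *: d by rewrite scale1r addrC subrK.
have sd0 : 0 <= \sum_i `|d i 0| by rewrite sumr_ge0.
have n0 : 0 <= n%:R :> R by [].
have sd : \sum_i `|d i 0| <= n%:R / Q%:R.
  apply: (@le_trans _ _ (\sum_(i < n) Q%:R^-1)).
    by apply: ler_sum => i _; rewrite !mxE; case: (hv i).
  by rewrite sumr_const card_ord -[_ *+ n]mulr_natl.
have nQ : n%:R / Q%:R * (1 + D) < 1.
  by rewrite mulrAC ltr_pdivrMr // mul1r.
have nQ0 : 0 <= n%:R / Q%:R :> R by rewrite divr_ge0.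
(* If [v] were zero, the error would be [q x] up to sign, of coordinate sum [q >= 1 > n/Q]. *)
have nz : nonzero_nat v.
  apply: contrapT => /natcv_eq0 v0.
  have q1 : 1 <= q%:R :> R by rewrite ler1n.
  have : \sum_i `|d i 0| = q%:R.
    transitivity (q%:R * \sum_i x i 0); last by rewrite sx mulr1.
    rewrite mulr_sumr; apply: eq_bigr => i _.
    by rewrite /d v0 !mxE add0r normrN normrM normr_nat (ger0_norm (x0 i)).
  by nra.
have := hB v nz; rewrite ev qf_expand // qx.
(* Each summand vanishes: [d] is zero off the support of [x], and [B x] is zero on it. *)
have -> : bf B d x = 0.
  rewrite /bf big1 // => i _; have [xi|/eqP xi] := eqVneq (x i 0) 0.
    apply: big1 => j _.
    by rewrite !mxE (proj2 (hv i)) // xi mulr0 subr0 !mul0r.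
  transitivity (d i 0 * \sum_j B i j * x j 0).
    by rewrite mulr_sumr; apply: eq_bigr => j _; rewrite mulrA.
  by rewrite (copositive_kernel cB x0 qx xi) mulr0.
have /ler_normlW := bf_norm_le d d hD; rewrite -qfE.
set S := \sum_i `|d i 0| in sd sd0 *; set e := n%:R / Q%:R in sd nQ nQ0.
move=> h; rewrite leNgt => /negP; apply.
rewrite expr1n !mulr0 mul1r !add0r; apply: le_lt_trans h _.
have : S * S <= e * e by rewrite ler_pM.
by nra.
Qed.

(** * Local finiteness *)

Lemma qf_trmx_continuous (R : realType) (n : nat) (B : 'M[R]_n) :
  continuous (fun v : 'rV[R]_n => qf B v^T).
Proof.
rewrite (_ : (fun v : 'rV[R]_n => _) = fun v : 'rV[R]_n => \sum_i \sum_j v 0 i * B i j * v 0 j).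
  apply: continuous_big => [|i _]; first exact: add_continuous.
  apply: continuous_big => [|j _]; first exact: add_continuous.
  move=> x.
  apply: (@continuousM R _ (fun v : 'rV[R]_n => v 0 i * B i j) (fun v => v 0 j)).
    apply: (@continuousM R _ (fun v : 'rV[R]_n => v 0 i) (fun=> B i j)).
      exact: coord_continuous.
    exact: cst_continuous.
  exact: coord_continuous.
apply/funext => v; rewrite qfE; apply: eq_bigr => i _; apply: eq_bigr => j _.
by rewrite !mxE.
Qed.

Lemma simplex_compact (R : realType) (n : nat) :
  compact ([set v : 'rV[R]_n | forall i, `[0, 1]%classic (v ord0 i)]
    `&` [set v | \sum_i v 0 i = 1])%classic.
Proof.
apply: compact_closedI.
  by apply: (@rV_compact R n (fun=> `[0, 1]%classic)) => _; exact: segment_compact.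
have /continuous_closedP : continuous (fun v : 'rV[R]_n => \sum_i v 0 i).
  apply: continuous_big => [|i _]; first exact: add_continuous.
  exact: coord_continuous.
by move/(_ [set x | x = 1]%classic); apply; exact: closed_eq.
Qed.

(** [c] is the minimum of [B] on the standard simplex, positive because [B] has no zero there;
    homogeneity extends the bound to the orthant. *)
Lemma RCOP_coercive (R : realType) (n : nat) (B : 'M[R]_n) :
  (0 < n)%N -> RCOP B ->
  exists2 c : R, 0 < c & forall x : 'cV[R]_n, (forall i, 0 <= x i 0) ->
    c * (\sum_i x i 0) ^+ 2 <= qf B x.
Proof.
move=> n0 RB; have cB := RCOP_copositive RB.
pose i0 := Ordinal n0.
set K := ([set v : 'rV[R]_n | forall i, `[0, 1]%classic (v ord0 i)]
    `&` [set v | \sum_i v 0 i = 1])%classic.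
have K0 : (K !=set0)%classic.
  exists (delta_mx 0 i0); split=> /= [i|].
    by rewrite in_itv /= mxE eqxx; case: eqP; rewrite /= ?lexx ?ler01.
  rewrite (bigD1 i0) //= big1 => [|k ki]; first by rewrite mxE !eqxx addr0.
  by rewrite mxE (negbTE ki) andbF.
have [v vK vmin] := EVT_min_rV K0 (@simplex_compact R n)
  (continuous_subspaceT (@qf_trmx_continuous R n B)).
have {vK} [v01 sv] := set_mem vK.
have vT0 i : 0 <= v^T i 0.
  by have := v01 i; rewrite /= in_itv /= mxE => /andP[].
have svT : \sum_i v^T i 0 = 1 by rewrite -[RHS]sv; apply: eq_bigr => i _; rewrite mxE.
exists (qf B v^T) => [|x x0].
  by rewrite lt0r (proj2 cB) // andbT; apply/eqP/RCOP_qf_neq0.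
set s := \sum_i x i 0.
have s0 : 0 <= s by rewrite sumr_ge0.
have [->|sn0] := eqVneq s 0; first by rewrite expr0n mulr0 (proj2 cB).
have sp : 0 < s by rewrite lt0r sn0.
have xs i : x i 0 <= s by rewrite /s (bigD1 i) //= lerDl sumr_ge0.
have := vmin (s^-1 *: x)^T; rewrite trmxK qf_scalev exprVn => h.
rewrite -ler_pdivlMr ?exprn_gt0 // mulrC; apply: h; apply/mem_set; split=> /= [i|].
  rewrite in_itv /= !mxE mulr_ge0 ?invr_ge0 //=.
  by rewrite mulrC ler_pdivrMr // mul1r.
under eq_bigr do rewrite !mxE.
by rewrite -mulr_sumr mulVf.
Qed.

Lemma finite_common_bound (R : realType) (I : finType) (P : I -> R -> Prop) :
  (forall i, exists2 e : R, 0 < e & forall t, 0 < t -> t <= e -> P i t) ->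
  exists2 e : R, 0 < e & forall i t, 0 < t -> t <= e -> P i t.
Proof.
move=> hP.
suff [e e0 he] : exists2 e : R, 0 < e &
    forall i, i \in enum I -> forall t, 0 < t -> t <= e -> P i t.
  by exists e => // i; apply: he; rewrite mem_enum.
elim: (enum I) => [|a s [e e0 he]]; first by exists 1.
have [d d0 hd] := hP a; exists (Num.min d e) => [|i]; first by rewrite lt_min d0.
by rewrite in_cons => /orP[/eqP ->|si] t t0; rewrite le_min => /andP[td te];
  [exact: hd|exact: he].
Qed.

(** Tight vectors do not decrease by hypothesis; the other vectors of a large box are finitely many
    and have slack; outside the box the quadratic growth of [B] dominates [Y]. *)
Lemma RCOP_small_step (R : realType) (n : nat) (B Y : 'M[R]_n) :
  (0 < n)%N -> RCOP B -> symmetric Y ->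
  (forall v, qf B (natcv R v) = 1 -> 0 <= qf Y (natcv R v)) ->
  exists2 t : R, 0 < t & RCOP (B + t *: Y).
Proof.
move=> n0 RB sY hY; have [sB hB] := RB.
have [c c0 hc] := RCOP_coercive n0 RB.
have [D D0 hD] := mx_entries_bounded Y.
(* If a coordinate reaches [N], the coordinate sum [s] satisfies [c s > 2], so half of [c s^2]
   already exceeds 1. *)
have [N N0 hN] := natr_unbounded (2 / c).
pose P (f : {ffun 'I_n -> 'I_N}) (t : R) := nonzero_nat (fun i => val (f i)) ->
  1 <= qf (B + t *: Y) (natcv R (fun i => val (f i))).
have [|e e0 he] := @finite_common_bound R _ P.
  move=> f; rewrite /P; set v := fun i : 'I_n => val (f i); set y := qf Y (natcv R v).
  have [B1|B1] := eqVneq (qf B (natcv R v)) 1.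
    exists 1 => // t t0 _ _; rewrite qfD qfZ B1 lerDl mulr_ge0 ?(ltW t0) //; exact: hY.
  have [nz|] := pselect (nonzero_nat v); last by exists 1.
  have B2 : 1 < qf B (natcv R v) by rewrite lt_neqAle eq_sym B1 hB.
  have yp : 0 < 1 + `|y| by rewrite ltr_pwDl.
  exists ((qf B (natcv R v) - 1) / (1 + `|y|)) => [|t t0].
    by rewrite divr_gt0 // subr_gt0.
  rewrite ler_pdivlMr // => ht _; rewrite qfD qfZ -/y.
  have : - (t * y) <= t * `|y|.
    by rewrite -mulrN ler_wpM2l ?(ltW t0) // -normrN ler_norm.
  by lra.
(* The second bound makes [t |Y[v]|] at most half of [c s^2], with [s] the coordinate sum. *)
pose t := Num.min e (c / (2 * D)).
have t0 : 0 < t by rewrite lt_min e0 divr_gt0 // mulr_gt0.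
have te : t <= e by rewrite ge_min lexx.
have tD : t * (2 * D) <= c by rewrite -ler_pdivlMr ?mulr_gt0 // ge_min lexx orbT.
exists t => //; split=> [|v nz]; first by apply: symmetricD => //; exact: symmetricZ.
have [/forallP sm|] := boolP [forall i, (v i < N)%N].
  have := he [ffun i => Ordinal (sm i)] t t0 te; rewrite /P.
  have -> : (fun i => val ([ffun i => Ordinal (sm i)] i)) = v.
    by apply/funext => i; rewrite ffunE.
  exact.
rewrite negb_forall => /existsP[i]; rewrite -leqNgt => Ni.
set x := natcv R v.
have x0 j : 0 <= x j 0 by rewrite mxE.
have := hc x x0; have /ler_normlP[hy _] := bf_norm_le x x hD; rewrite -qfE in hy.
have ex : \sum_j `|x j 0| = \sum_j x j 0 by apply: eq_bigr => j _; rewrite ger0_norm.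
rewrite ex in hy; rewrite qfD qfZ; set s := \sum_j x j 0 in hy *.
have sN : N%:R <= s.
  rewrite /s (bigD1 i) //= -[X in X <= _]addr0 lerD ?sumr_ge0 //.
  by rewrite mxE ler_nat.
have N1 : 1 <= N%:R :> R by rewrite ler1n.
rewrite expr2 => h1.
have h2 : s <= s * s by rewrite ler_peMl; lra.
have h3 : 2 < c * s.
  rewrite ltr_pdivrMr // mulrC in hN; apply: lt_le_trans hN _.
  by rewrite ler_wpM2l // ltW.
have h4 : - (t * qf Y x) <= t * (D * (s * s)) by rewrite -mulrN ler_wpM2l // ltW.
have h5 : t * (2 * D) * (s * s) <= c * (s * s) by rewrite ler_wpM2r //; nra.
have h6 : c * s <= c * (s * s) by rewrite ler_wpM2l // ltW.
by lra.
Qed.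

(** [t] is the supremum of the admissible times, finite since [Y] is negative somewhere. It is
    itself admissible, and if no vector with [Y[v] < 0] were tight there, a further small step would
    be possible. *)
Lemma RCOP_ray_end (R : realType) (n : nat) (B Y : 'M[R]_n) :
  (0 < n)%N -> RCOP B -> symmetric Y -> (exists v, qf Y (natcv R v) < 0) ->
  exists2 t : R, 0 <= t & RCOP (B + t *: Y) /\
    exists2 v, qf (B + t *: Y) (natcv R v) = 1 & qf Y (natcv R v) < 0.
Proof.
move=> n0 RB sY [v0 hv0]; have [sB hB] := RB.
pose T : set R := [set t | 0 <= t /\ RCOP (B + t *: Y)]%classic.
have T0 : T 0 by split=> //; rewrite scale0r addr0.
have nzY v : qf Y (natcv R v) < 0 -> nonzero_nat v.
  move=> hv; apply: contrapT => /natcv_eq0 v00; move: hv.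
  by rewrite v00 qf0 ltxx.
have Tub v : qf Y (natcv R v) < 0 ->
    ubound T ((qf B (natcv R v) - 1) / - qf Y (natcv R v)).
  move=> hv t [t0 [_ /(_ v (nzY v hv))]]; rewrite qfD qfZ => h.
  by rewrite ler_pdivlMr ?oppr_gt0 //; lra.
have hT : has_ubound T by eexists; exact: Tub hv0.
pose t := sup T.
have t0 : 0 <= t by exact: ub_le_sup.
have sBY u : symmetric (B + u *: Y) by apply: symmetricD => //; exact: symmetricZ.
have RBt : RCOP (B + t *: Y).
  split=> // v nz; rewrite qfD qfZ leNgt; apply/negP => hlt.
  have B1 := hB v nz.
  have hv : qf Y (natcv R v) < 0.
    rewrite ltNge; apply/negP => y0.
    have := mulr_ge0 t0 y0; lra.
  have : t <= (qf B (natcv R v) - 1) / - qf Y (natcv R v).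
    by apply: ge_sup; [exists 0|exact: Tub].
  by rewrite ler_pdivlMr ?oppr_gt0 //; lra.
exists t => //; split=> //; apply: contrapT => hno.
have [|s s0 Rs] := RCOP_small_step n0 RBt sY.
  move=> v hv; rewrite leNgt; apply/negP => hlt; apply: hno; by exists v.
have : t + s <= t.
  apply: ub_le_sup => //; split; first by rewrite addr_ge0 // ltW.
  by rewrite scalerDl addrA.
by lra.
Qed.

(** * Directions in a face *)

Definition nat_copositive (R : realType) (n : nat) (X : 'M[R]_n) : Prop :=
  forall v, 0 <= qf X (natcv R v).

(** Replaces small perturbations of [v]: among integer vectors, a large multiple [N v] is perturbed
    instead. *)
Lemma nat_affine_ge0 (R : realType) (g h : R) :
  (forall N : nat, (0 < N)%N -> 0 <= N%:R * g + h) -> 0 <= g.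
Proof.
move=> H; rewrite leNgt; apply/negP => g0.
have [N N0] := natr_unbounded (h / - g).
by rewrite ltr_pdivrMr ?oppr_gt0 // => hN; have := H N N0; lra.
Qed.

(** Integer version of the kernel argument: [X[N v + e_i] = 2 N (X v)_i + X_ii] bounds [(X v)_i]
    from below, and [N v - e_i] bounds it from above. *)
Lemma nat_copositive_zero (R : realType) (n : nat) (X : 'M[R]_n) (v : 'I_n -> nat)
    (i : 'I_n) :
  symmetric X -> nat_copositive X -> qf X (natcv R v) = 0 ->
  (v i)%:R * \sum_j X i j * (v j)%:R = 0.
Proof.
move=> sX cX qv; have [->|vi] := eqVneq (v i) 0%N; first by rewrite mul0r.
have vi0 : (0 < v i)%N by rewrite lt0n.
have -> : \sum_j X i j * (v j)%:R = bf X (delta_mx i 0) (natcv R v).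
  by rewrite bf_delta; apply: eq_bigr => j _; rewrite mxE.
set g := bf _ _ _.
have g0 : 0 <= 2 * g.
  apply: (@nat_affine_ge0 _ _ (X i i)) => N N0.
  have := cX (fun j => N * v j + (j == i))%N.
  have -> : natcv R (fun j => N * v j + (j == i))%N =
      N%:R *: natcv R v + 1 *: delta_mx i 0.
    by apply/colP => j; rewrite !mxE natrD natrM eqxx andbT mul1r.
  by rewrite qf_expand // qv qf_delta -/g expr1n; lra.
have g1 : 0 <= 2 * - g.
  apply: (@nat_affine_ge0 _ _ (X i i)) => N N0.
  have := cX (fun j => N * v j - (j == i))%N.
  have -> : natcv R (fun j => N * v j - (j == i))%N =
      N%:R *: natcv R v + -1 *: delta_mx i 0.
    (* The natural subtraction is exact, since [N] and [v_i] are positive. *)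
    apply/colP => j; rewrite !mxE natrB ?natrM ?eqxx ?andbT ?mulN1r //.
    by case: eqP => [->|//]; rewrite muln_gt0 N0.
  by rewrite qf_expand // qv qf_delta -/g sqrrN expr1n; lra.
by rewrite (_ : g = 0) ?mulr0 //; lra.
Qed.

Lemma natcv_delta (R : realType) (n : nat) (i : 'I_n) :
  natcv R (fun j => nat_of_bool (j == i)) = delta_mx i 0.
Proof. by apply/colP => j; rewrite !mxE eqxx andbT. Qed.

Lemma nat_copositive_diag_ge0 (R : realType) (n : nat) (X : 'M[R]_n) (i : 'I_n) :
  nat_copositive X -> 0 <= X i i.
Proof. by move=> cX; have := cX (fun j => nat_of_bool (j == i)); rewrite natcv_delta qf_delta. Qed.

(** With [X_ii = 0], [X[N e_i + e_j]] is affine in [N] with slope [2 X_ji]. *)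
Lemma nat_copositive_row_ge0 (R : realType) (n : nat) (X : 'M[R]_n) (i j : 'I_n) :
  symmetric X -> nat_copositive X -> X i i = 0 -> 0 <= X j i.
Proof.
move=> sX cX Xi.
suff : 0 <= 2 * X j i by lra.
apply: (@nat_affine_ge0 _ _ (X j j)) => N N0.
have := cX (fun k => N * (k == i) + (k == j))%N.
have -> : natcv R (fun k => N * (k == i) + (k == j))%N =
    N%:R *: delta_mx i 0 + 1 *: delta_mx j 0.
  by apply/colP => k; rewrite !mxE natrD natrM eqxx !andbT mul1r.
rewrite qf_expand // !qf_delta Xi bf_delta (bigD1 i) //= big1 => [|k ki].
  by rewrite mxE !eqxx /= expr1n; lra.
by rewrite mxE (negbTE ki) mulr0.
Qed.

(** [e_i e_i^T X] plus its transpose: its form is twice the [i]-th summand of [X[x] = sum_i x_i (X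
    x)_i]. *)
Definition row_part (R : realType) (n : nat) (X : 'M[R]_n) (i : 'I_n) : 'M[R]_n :=
  \matrix_(a, b) ((a == i)%:R * X i b + (b == i)%:R * X i a).

Lemma symmetric_row_part (R : realType) (n : nat) (X : 'M[R]_n) (i : 'I_n) :
  symmetric (row_part X i).
Proof. by apply/matrixP => a b; rewrite !mxE addrC. Qed.

Lemma qf_row_part (R : realType) (n : nat) (X : 'M[R]_n) (i : 'I_n) (x : 'cV[R]_n) :
  qf (row_part X i) x = 2 * (x i 0 * \sum_j X i j * x j 0).
Proof.
pose A : 'M[R]_n := \matrix_(a, b) ((a == i)%:R * X i b).
have -> : row_part X i = A + A^T by apply/matrixP => a b; rewrite !mxE.
rewrite qfD qf_trmx; suff -> : qf A x = x i 0 * \sum_j X i j * x j 0 by ring.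
rewrite qfE /bf (bigD1 i) //= [X in _ + X]big1 ?addr0 => [|k ki].
  by rewrite mulr_sumr; apply: eq_bigr => j _; rewrite mxE eqxx mul1r mulrA.
by apply: big1 => j _; rewrite mxE (negbTE ki) mul0r mulr0 mul0r.
Qed.

(* If [X] is copositive and vanishes at [v >= 0], then [v_i (X v)_i = 0] for every [i]; hence
   the matrices [row_part X i] vanish wherever [X] does. *)
Lemma nat_copositive_face (R : realType) (n : nat) (M : ('I_n -> nat) -> Prop) (X : 'M[R]_n) :
  (2 <= n)%N -> symmetric X -> X <> 0 -> nat_copositive X ->
  (forall v, M v -> qf X (natcv R v) = 0) ->
  (exists i j : 'I_n, i <> j /\ forall v, M v -> qf (Emx R i j) (natcv R v) = 0) \/
  (exists Y : 'M[R]_n, symmetric Y /\ (forall v, M v -> qf Y (natcv R v) = 0) /\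
    (exists u, qf Y (natcv R u) < 0) /\ (exists w, 0 < qf Y (natcv R w))).
Proof.
move=> n2 sX X0 cX hX.
have [[i Xii]|nd] := pselect (exists i, 0 < X i i).
  have Zi v : M v -> (v i)%:R * \sum_j X i j * (v j)%:R = 0.
    by move=> /hX; exact: nat_copositive_zero.
  have Yv v : qf (row_part X i) (natcv R v) = 2 * ((v i)%:R * \sum_j X i j * (v j)%:R).
    by rewrite qf_row_part mxE; under eq_bigr do rewrite mxE.
  have [neg|npos] := pselect (exists u, qf (row_part X i) (natcv R u) < 0).
    right; exists (row_part X i); split; first exact: symmetric_row_part.
    split=> [v Mv|]; first by rewrite Yv Zi // mulr0.
    split=> //; exists (fun j => nat_of_bool (j == i)).
    by rewrite natcv_delta qf_delta mxE eqxx !mul1r addr_gt0.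
  have cY : nat_copositive (row_part X i).
    by move=> v; rewrite leNgt; apply/negP => h; apply: npos; exists v.
  (* Off [i] the diagonal of [row_part X i] is zero, so its copositivity makes the [i]-th row of [X]
     nonnegative. *)
  have Xij j : 0 <= X i j.
    have [->|ji] := eqVneq j i; first exact: ltW.
    have := @nat_copositive_row_ge0 _ _ _ j i (symmetric_row_part X i) cY.
    by rewrite !mxE eqxx (negbTE ji) !mul0r addr0 mul1r addr0; apply.
  left; have [j ji] : exists j : 'I_n, i <> j.
    apply: contrapT => h; have : (#|'I_n| <= 1)%N; last by rewrite card_ord leqNgt n2.
    apply/card_le1_eqP => a b _ _.
    have e k : i = k by apply: contrapT => ik; apply: h; exists k.
    by rewrite -(e a) -(e b).
  exists i, j; split=> // v Mv; rewrite qf_Emx !mxE.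
  have [->|vi] := eqVneq (v i) 0%N; first by rewrite mul0r mulr0.
  have vp : 0 < (v i)%:R :> R by rewrite ltr0n lt0n.
  (* Here [v_i > 0], so [(X v)_i >= X_ii v_i > 0], contradicting [v_i (X v)_i = 0]. Thus [v_i = 0]
     on [M], and any [j] will do. *)
  have /eqP := Zi v Mv; rewrite mulf_eq0 (gt_eqF vp) /= (bigD1 i) //= gt_eqF //.
  by rewrite ltr_pwDl ?mulr_gt0 // sumr_ge0 // => k _; rewrite mulr_ge0.
(* With zero diagonal all entries are nonnegative, so [X[v] = 0] kills every term, and a nonzero
   [X_ij] forces [v_i v_j = 0]. *)
have Xii i : X i i = 0.
  have := nat_copositive_diag_ge0 i cX; rewrite le0r => /orP[/eqP //|h].
  by case: nd; exists i.
have Xij i j : 0 <= X i j by exact: nat_copositive_row_ge0.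
have [i [j Xn]] : exists i j, X i j != 0.
  apply: contrapT => h; apply: X0; apply/matrixP => i j; rewrite mxE.
  by apply/eqP/negPn/negP => hij; apply: h; exists i, j.
left; exists i, j; split=> [e|v Mv]; first by rewrite e Xii eqxx in Xn.
have := hX v Mv; rewrite qfE /bf => /eqP; rewrite psumr_eq0 => [/allP|a _]; last first.
  by apply: sumr_ge0 => b _; rewrite !mxE !mulr_ge0.
move/(_ i (mem_index_enum i)) => /=; rewrite psumr_eq0 => [/allP|b _]; last first.
  by rewrite !mxE !mulr_ge0.
move/(_ j (mem_index_enum j)) => /=; rewrite mulrAC mulf_eq0 (negbTE Xn) orbF.
by rewrite qf_Emx => /eqP ->; rewrite mulr0.
Qed.

(** Either [X] takes both signs and serves as [Y], or it is copositive on integer vectors up to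
    sign. *)
Lemma face_direction (R : realType) (n : nat) (M : ('I_n -> nat) -> Prop) (X : 'M[R]_n) :
  (2 <= n)%N -> symmetric X -> X <> 0 ->
  (forall v, M v -> qf X (natcv R v) = 0) ->
  (exists i j : 'I_n, i <> j /\ forall v, M v -> qf (Emx R i j) (natcv R v) = 0) \/
  (exists Y : 'M[R]_n, symmetric Y /\ (forall v, M v -> qf Y (natcv R v) = 0) /\
    (exists u, qf Y (natcv R u) < 0) /\ (exists w, 0 < qf Y (natcv R w))).
Proof.
move=> n2 sX X0 hX.
have [neg|nneg] := pselect (exists u, qf X (natcv R u) < 0); last first.
  apply: (nat_copositive_face n2 sX X0) => // v.
  by rewrite leNgt; apply/negP => h; apply: nneg; exists v.
have [pos|npos] := pselect (exists u, 0 < qf X (natcv R u)).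
  by right; exists X.
apply: (@nat_copositive_face _ _ M (-1 *: X)) => //.
- exact: symmetricZ.
- by rewrite scaleN1r => /eqP; rewrite oppr_eq0 => /eqP.
- move=> v; rewrite qfZ mulN1r oppr_ge0 leNgt; apply/negP => h; apply: npos.
  by exists v.
- by move=> v /hX; rewrite qfZ => ->; rewrite mulr0.
Qed.

(** * Decomposition *)

Lemma minCOP_min (R : realType) (n : nat) (B : 'M[R]_n) (v : 'I_n -> nat) :
  RCOP B -> qf B (natcv R v) = 1 -> minCOP B = 1.
Proof.
move=> [sB hB] v1.
have nz : nonzero_nat v.
  apply: contrapT => /natcv_eq0 v0; move: v1.
  rewrite v0 qf0 => /eqP.
  by rewrite eq_sym oner_eq0.
have lb : lbound [set qf B (natcv R v) | v in [set v | nonzero_nat v]]%classic 1.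
  by move=> _ [w nw <-]; exact: hB.
apply/eqP; rewrite eq_le; apply/andP; split.
  by rewrite -[leRHS]v1; apply: ge_inf; [exists 1|exists v].
by apply: lb_le_inf => //; eexists; exists v.
Qed.

(** The coercivity constant serves as radius: a perturbation with entries at most [c] changes [B[x]]
    by at most [c (sum x)^2 <= B[x]]. *)
Lemma RCOP_strictly_copositive (R : realType) (n : nat) (B : 'M[R]_n) :
  (0 < n)%N -> RCOP B -> strictly_copositive B.
Proof.
move=> n0 RB; have [sB _] := RB; split=> //.
have [c c0 hc] := RCOP_coercive n0 RB; exists c; split=> // C sC hC; split=> // x x0.
have hD i j : `|(C - B) i j| <= c by rewrite !mxE ltW.
have /ler_normlP[h _] := bf_norm_le x x hD; rewrite -qfE in h.
have ex : \sum_j `|x j 0| = \sum_j x j 0 by apply: eq_bigr => j _; rewrite ger0_norm.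
have hx := hc x x0; rewrite ex -expr2 in h.
have -> : qf C x = qf B x + qf (C - B) x by rewrite -qfD addrC subrK.
by lra.
Qed.

Lemma RCOP_vertex_perfect (R : realType) (n : nat) (B : 'M[R]_n) :
  (0 < n)%N -> RCOP B ->
  (forall Y, symmetric Y -> (forall v, qf B (natcv R v) = 1 -> qf Y (natcv R v) = 0) -> Y = 0) ->
  perfect_min1 B.
Proof.
move=> n0 RB hY; have [sB hB] := RB.
have [v v1] : exists v, qf B (natcv R v) = 1.
  (* Without tight vectors the hypothesis would apply to [B] itself. *)
  apply: contrapT => h; have B0 : B = 0 by apply: hY => // v v1; case: h; exists v.
  have : 1 <= qf B (natcv R (fun=> 1%N)) by apply: hB; exists (Ordinal n0).
  by rewrite B0 qf0mx ler10.
have m1 := minCOP_min RB v1.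
split=> //; split=> [|Q sQ hQ]; first exact: RCOP_strictly_copositive.
apply/eqP; rewrite -subr_eq0; apply/eqP/hY.
  by rewrite -scaleN1r; apply: symmetricD => //; exact: symmetricZ.
move=> w w1; rewrite -scaleN1r qfD qfZ w1 hQ ?m1 //; last by rewrite /MinCOP m1.
by ring.
Qed.

(** * The inclusion from right to left *)

Lemma perfect_min1_RCOP (R : realType) (n : nat) (P : 'M[R]_n) :
  perfect_min1 P -> RCOP P.
Proof.
move=> [[[sP [e [e0 he]]] _] m1]; split=> // v nz; rewrite -[X in X <= _]m1.
have [|_ cP] := he P sP; first by move=> i j; rewrite subrr normr0.
apply: ge_inf; last by exists v.
(* Copositivity bounds the set of values below, so that [inf] is a genuine lower bound. *)
by exists 0 => _ [w _ <-]; apply: cP => i; rewrite mxE.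
Qed.

Lemma conv_RCOP (R : realType) (n : nat) (Y : 'M[R]_n) :
  conv (@perfect_min1 R n) Y -> RCOP Y.
Proof.
move=> [k [A [c [hA [c0 [c1 ->]]]]]]; split=> [|v nz].
  by apply: symmetric_sum => l; apply: symmetricZ; case: (perfect_min1_RCOP (hA l)).
rewrite qf_sum -[X in X <= _]c1; apply: ler_sum => l _; rewrite qfZ ler_peMr //.
by case: (perfect_min1_RCOP (hA l)) => _; apply.
Qed.

Lemma RCOP_add_cone (R : realType) (n : nat) (Y Z : 'M[R]_n) :
  RCOP Y -> cone (@E_offdiag R n) Z -> RCOP (Y + Z).
Proof.
move=> [sY hY] [k [A [c [hA [c0 ->]]]]]; split=> [|v nz].
  apply: symmetricD => //; apply: symmetric_sum => l; apply: symmetricZ.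
  by have [i [j [_ ->]]] := hA l; exact: symmetric_Emx.
rewrite qfD -[X in X <= _]addr0 lerD ?hY // qf_sum sumr_ge0 // => l _.
rewrite qfZ mulr_ge0 //; have [i [j [_ ->]]] := hA l.
by rewrite qf_Emx !mxE !mulr_ge0.
Qed.

(** * Closure properties of decompositions *)

Lemma cone_comb (R : realType) (n : nat) (S : 'M[R]_n -> Prop) (X Y : 'M[R]_n) (a b : R) :
  0 <= a -> 0 <= b -> cone S X -> cone S Y -> cone S (a *: X + b *: Y).
Proof.
move=> a0 b0 [k [A [c [hA [c0 ->]]]]] [m [A' [c' [hA' [c0' ->]]]]].
exists (k + m)%N, (fun l => match split l with inl i => A i | inr j => A' j end),
  (fun l => match split l with inl i => a * c i | inr j => b * c' j end).
split; first by move=> l; case: split.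
split; first by move=> l; case: split => i; exact: mulr_ge0.
rewrite big_split_ord !scaler_sumr; congr (_ + _); apply: eq_bigr => l _.
  by rewrite (unsplitK (inl l)) scalerA.
by rewrite (unsplitK (inr l)) scalerA.
Qed.

Lemma conv_comb (R : realType) (n : nat) (S : 'M[R]_n -> Prop) (X Y : 'M[R]_n) (a b : R) :
  0 <= a -> 0 <= b -> a + b = 1 -> conv S X -> conv S Y -> conv S (a *: X + b *: Y).
Proof.
move=> a0 b0 ab [k [A [c [hA [c0 [c1 ->]]]]]] [m [A' [c' [hA' [c0' [c1' ->]]]]]].
exists (k + m)%N, (fun l => match split l with inl i => A i | inr j => A' j end),
  (fun l => match split l with inl i => a * c i | inr j => b * c' j end).
split; first by move=> l; case: split.
split; first by move=> l; case: split => i; exact: mulr_ge0.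
split.
  rewrite big_split_ord -[RHS]ab -[X in X + _]mulr1 -[X in _ + X]mulr1.
  rewrite -[X in a * X]c1 -[X in b * X]c1' !mulr_sumr.
  congr (_ + _); apply: eq_bigr => l _.
    by rewrite (unsplitK (inl l)).
  by rewrite (unsplitK (inr l)).
rewrite big_split_ord !scaler_sumr; congr (_ + _); apply: eq_bigr => l _.
  by rewrite (unsplitK (inl l)) scalerA.
by rewrite (unsplitK (inr l)) scalerA.
Qed.

Definition decomposable (R : realType) (n : nat) (B : 'M[R]_n) : Prop :=
  exists Y Z : 'M[R]_n,
    conv (@perfect_min1 R n) Y /\ cone (@E_offdiag R n) Z /\ B = Y + Z.

Lemma decomposable_perfect (R : realType) (n : nat) (P : 'M[R]_n) :
  perfect_min1 P -> decomposable P.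
Proof.
move=> pP; exists P, 0; split; last split; last by rewrite addr0.
  exists 1%N, (fun=> P), (fun=> 1); do 2!split=> //.
  by rewrite !big_ord1 scale1r.
by exists 0%N, (fun=> 0), (fun=> 0); split=> [[]//|]; split=> //; rewrite big_ord0.
Qed.

Lemma decomposable_addE (R : realType) (n : nat) (B : 'M[R]_n) (i j : 'I_n) (t : R) :
  0 <= t -> i <> j -> decomposable B -> decomposable (B + t *: Emx R i j).
Proof.
move=> t0 ij [Y [Z [hY [hZ ->]]]]; exists Y, (1 *: Z + t *: Emx R i j).
split=> //; split; last by rewrite scale1r addrA.
apply: cone_comb => //; exists 1%N, (fun=> Emx R i j), (fun=> 1).
split=> [_|]; first by exists i, j.
by split=> //; rewrite big_ord1 scale1r.
Qed.

Lemma decomposable_comb (R : realType) (n : nat) (A B : 'M[R]_n) (a b : R) :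
  0 <= a -> 0 <= b -> a + b = 1 -> decomposable A -> decomposable B ->
  decomposable (a *: A + b *: B).
Proof.
move=> a0 b0 ab [Y [Z [hY [hZ ->]]]] [Y' [Z' [hY' [hZ' ->]]]].
exists (a *: Y + b *: Y'), (a *: Z + b *: Z').
split; first exact: conv_comb.
split; first exact: cone_comb.
by rewrite !scalerDr addrACA.
Qed.

(** * Induction on independent tight constraints *)

Definition outer (R : realType) (n : nat) (v : 'I_n -> nat) : 'M[R]_n :=
  natcv R v *m (natcv R v)^T.

Lemma mxtrace_outer (R : realType) (n : nat) (Y : 'M[R]_n) (v : 'I_n -> nat) :
  \tr (Y *m outer R v) = qf Y (natcv R v).
Proof. by rewrite /outer mulmxA mxtrace_mulC mulmxA /mxtrace big_ord1. Qed.

(** The trace pairing with [Y] is a linear functional that vanishes on the span but not at [A]. *)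
Lemma notin_span_mxtrace (R : realType) (n : nat) (Y A : 'M[R]_n) (s : seq 'M[R]_n) :
  (forall C, C \in s -> \tr (Y *m C) = 0) -> \tr (Y *m A) <> 0 -> A \notin <<s>>%VS.
Proof.
move=> hs hA; apply/negP => /(@coord_span _ _ _ (in_tuple s)) eA; apply: hA.
rewrite eA mulmx_sumr raddf_sum big1 // => i _ /=.
by rewrite -scalemxAr mxtraceZ hs ?mulr0 // mem_nth.
Qed.

(** The size of [s] bounds the codimension of [W(B)] from below, so enlarging [s] stands for the
    descent in [dim W]. *)
Definition tight_family (R : realType) (n : nat) (B : 'M[R]_n) (s : seq 'M[R]_n) : Prop :=
  free s /\ forall A, A \in s -> exists2 v, A = outer R v & qf B (natcv R v) = 1.

(** [Y] vanishes at the old tight vectors, which therefore stay tight, and is negative at the new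
    one, whose outer product is therefore independent of those in [s]. *)
Lemma tight_family_extend (R : realType) (n : nat) (B Y : 'M[R]_n) (s : seq 'M[R]_n) :
  (0 < n)%N -> RCOP B -> tight_family B s -> symmetric Y ->
  (forall v, qf B (natcv R v) = 1 -> qf Y (natcv R v) = 0) ->
  (exists u, qf Y (natcv R u) < 0) ->
  exists2 t : R, 0 <= t & RCOP (B + t *: Y) /\
    exists A, tight_family (B + t *: Y) (A :: s).
Proof.
move=> n0 RB [fs hs] sY hY neg.
have [t t0 [Rt [v v1 yv]]] := RCOP_ray_end n0 RB sY neg.
exists t => //; split=> //; exists (outer R v); split.
  rewrite free_cons fs andbT; apply: (@notin_span_mxtrace _ _ Y) => [C /hs[w ->]|].
    by rewrite mxtrace_outer; exact: hY.
  by rewrite mxtrace_outer => y0; rewrite y0 ltxx in yv.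
move=> C; rewrite in_cons => /orP[/eqP ->|/hs[w -> w1]]; first by exists v.
by exists w => //; rewrite qfD qfZ hY // mulr0 addr0.
Qed.

(** Induction on [m], which bounds the room left for enlarging [s]; as [s] is free, [m = 0] is
    impossible. *)
Lemma tight_family_decomposable (R : realType) (n m : nat) (B : 'M[R]_n) (s : seq 'M[R]_n) :
  (2 <= n)%N -> RCOP B -> tight_family B s ->
  (\dim {: 'M[R]_n} < size s + m)%N -> decomposable B.
Proof.
move=> n2; have n0 : (0 < n)%N by exact: ltn_trans n2.
elim: m B s => [|m IH] B s RB hs hm.
  case: hs => /eqP fs _; have := dimvS (subvf <<s>>%VS).
  by rewrite fs leqNgt -[size s]addn0 hm.
have ext Y : symmetric Y -> (forall v, qf B (natcv R v) = 1 -> qf Y (natcv R v) = 0) ->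
    (exists u, qf Y (natcv R u) < 0) ->
    exists2 t : R, 0 <= t & decomposable (B + t *: Y).
  move=> sY hY neg.
  have [t t0 [Rt [A hA]]] := tight_family_extend n0 RB hs sY hY neg.
  by exists t => //; apply: IH Rt hA _; rewrite /= addSnnS.
have [[X [sX [X0 hX]]]|none] := pselect (exists X, symmetric X /\ X <> 0 /\
    forall v, qf B (natcv R v) = 1 -> qf X (natcv R v) = 0); last first.
  apply: decomposable_perfect; apply: RCOP_vertex_perfect => // Y sY hY.
  by apply: contrapT => Y0; apply: none; exists Y.
have [[i [j [ij hE]]]|[Y [sY [hY [neg [w pos]]]]]] :=
    @face_direction _ _ (fun v => qf B (natcv R v) = 1) X n2 sX X0 hX.
  have [| | |t t0 dt] := ext (-1 *: Emx R i j).
  - by apply: symmetricZ; exact: symmetric_Emx.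
  - by move=> v /hE; rewrite qfZ => ->; rewrite mulr0.
  (* At the all-ones vector [-E_ij] takes the value [-2]. *)
  - by exists (fun=> 1%N); rewrite qfZ qf_Emx !mxE; lra.
  have -> : B = B + t *: (-1 *: Emx R i j) + t *: Emx R i j.
    by rewrite scaleN1r scalerN subrK.
  exact: decomposable_addE.
have [t t0 dt] := ext Y sY hY neg.
have [| | |u u0 du] := ext (-1 *: Y).
- exact: symmetricZ.
- by move=> v /hY; rewrite qfZ => ->; rewrite mulr0.
- by exists w; rewrite qfZ mulN1r oppr_lt0.
have [tu0|tu0] := eqVneq (t + u) 0.
  suff t00 : t = 0 by move: dt; rewrite t00 scale0r addr0.
  by lra.
(* The weights are crossed so that the contributions of [t Y] and [-u Y] cancel. *)
have -> : B = (u / (t + u)) *: (B + t *: Y) + (t / (t + u)) *: (B + u *: (-1 *: Y)).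
  by apply/matrixP => a b; rewrite !mxE; field.
apply: decomposable_comb => //; rewrite ?divr_ge0 ?addr_ge0 //.
by field.
Qed.

Theorem theorem7p1 (R : realType) (n : nat) (hn : (2 <= n)%N) (B : 'M[R]_n) :
  RCOP B <->
  exists Y Z : 'M[R]_n,
    conv (@perfect_min1 R n) Y /\ cone (@E_offdiag R n) Z /\ B = Y + Z.
Proof.
split=> [RB|[Y [Z [hY [hZ ->]]]]]; last exact: RCOP_add_cone (conv_RCOP hY) hZ.
(* The induction starts from the empty family; [m] is one more than the dimension because the
   inequality is strict. *)
apply: (@tight_family_decomposable _ _ (\dim {: 'M[R]_n}).+1 B [::]) => //.
by split=> //; exact: nil_free.
Qed.
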